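(* Consider two energy-based systems (as defined in the context), namely, for $i=1,2$, $$\begin{bmatrix}\partial_1H^{[i]}\\ \dot z_2^{[i]}\\ 0\end{bmatrix}=\big(\mathbf{J}^{[i]}-\mathbf{R}^{[i]}\big)\begin{bmatrix}\dot z_1^{[i]}\\ \partial_2H^{[i]}\\ z_3^{[i]}\end{bmatrix}+\begin{bmatrix}\mathbf{B}_1^{[i]}\\ \mathbf{B}_2^{[i]}\\ \mathbf{B}_3^{[i]}\end{bmatrix}u^{[i]},\qquad y^{[i]}=\begin{bmatrix}\mathbf{B}_1^{[i]\,T}&\mathbf{B}_2^{[i]\,T}&\mathbf{B}_3^{[i]\,T}\end{bmatrix}\begin{bmatrix}\dot z_1^{[i]}\\ \partial_2H^{[i]}\\ z_3^{[i]}\end{bmatrix},$$ with respective states $z^{[1]},z^{[2]}$ and energy functions $H^{[1]},H^{[2]}$, where $\partial_kH^{[i]}$ is short for $\partial_{z_k^{[i]}}H^{[i]}$. Then an interconnection of the form $$\begin{bmatrix} u^{[1]} \\ u^{[2]} \end{bmatrix}=\big(\mathbf{F}_{\text{skew}}-\mathbf{F}_{\text{sym}}\big)\begin{bmatrix} y^{[1]} \\ y^{[2]} \end{bmatrix}+\begin{bmatrix}\tilde u^{[1]}\\ \tilde u^{[2]}\end{bmatrix}$$ with $\mathbf{F}_{\text{skew}}=-\mathbf{F}_{\text{skew}}^T$ and positive semi-definite $\mathbf{F}_{\text{sym}}=\mathbf{F}_{\text{sym}}^T$ yields again an energy-based system.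
   Context: An energy-based system with state $z=[z_1;z_2;z_3]\in\mathbb{R}^{n_1+n_2+n_3}$, $n=n_1+n_2+n_3$, energy function $H=H(z_1,z_2)$, and input and output $u,y\in\mathbb{R}^m$ is a system of the form $$\begin{bmatrix}\partial_{z_1}H\\ \dot z_2\\ 0\end{bmatrix}=(\mathbf{J}-\mathbf{R})\begin{bmatrix}\dot z_1\\ \partial_{z_2}H\\ z_3\end{bmatrix}+\begin{bmatrix}\mathbf{B}_1\\ \mathbf{B}_2\\ \mathbf{B}_3\end{bmatrix}u,\qquad y=\begin{bmatrix}\mathbf{B}_1^T&\mathbf{B}_2^T&\mathbf{B}_3^T\end{bmatrix}\begin{bmatrix}\dot z_1\\ \partial_{z_2}H\\ z_3\end{bmatrix}$$ with constant matrices $\mathbf{J}=-\mathbf{J}^T\in\mathbb{R}^{n,n}$, $\mathbf{R}=\mathbf{R}^T\in\mathbb{R}^{n,n}$ positive semi-definite, and $\mathbf{B}_i\in\mathbb{R}^{n_i,m}$ arbitrary. Here $[x;y]$ denotes vertical stacking of column vectors, a dot is the time derivative, and $\partial_{z_k}H$ is the partial gradient (column vector) of $H$ with respect to $z_k$. In the claim, $z^{[i]}=[z_1^{[i]};z_2^{[i]};z_3^{[i]}]$, and $u^{[i]},y^{[i]},\mathbf{J}^{[i]},\mathbf{R}^{[i]},\mathbf{B}_j^{[i]}$ are the input, output and matrices of the $i$-th system; $\tilde u^{[1]},\tilde u^{[2]}$ are new inputs of the same sizes as $u^{[1]},u^{[2]}$, and $\mathbf{F}_{\text{skew}},\mathbf{F}_{\text{sym}}$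 are real square matrices of compatible size. *)

(* Defs.v *)
From HB Require Import structures.
From mathcomp Require Import all_boot all_order all_algebra.
From mathcomp Require Import all_classical all_reals all_analysis.

Set Implicit Arguments.
Unset Strict Implicit.
Unset Printing Implicit Defensive.

Import Order.TTheory GRing.Theory Num.Theory.
Import numFieldNormedType.Exports.

Local Open Scope classical_set_scope.
Local Open Scope ring_scope.

Definition psdmx (R : realType) (n : nat) (A : 'M[R]_n) : Prop :=
  forall x : 'cV[R]_n, 0 <= (x^T *m A *m x) 0 0.

Definition gradient (R : realType) (n : nat) (f : 'cV[R]_n -> R)
    (x : 'cV[R]_n) : 'cV[R]_n :=
  \col_i ('D_(delta_mx i 0) f x).

(* The block sizes may be 0. *)
Record energy_system (R : realType) (n1 n2 n3 m : nat) := EnergySystem {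
  energy : 'cV[R]_n1 * 'cV[R]_n2 -> R;
  Jmx : 'M[R]_(n1 + (n2 + n3));
  Rmx : 'M[R]_(n1 + (n2 + n3));
  B1mx : 'M[R]_(n1, m);
  B2mx : 'M[R]_(n2, m);
  B3mx : 'M[R]_(n3, m);
  energy_differentiable : forall z, differentiable energy z;
  Jmx_skew : Jmx = - Jmx^T;
  Rmx_sym : Rmx = Rmx^T;
  Rmx_psd : psdmx Rmx }.

(* The input is denoted [u] and the output [y], with values in 'cV_m. The
   equations are required to hold at every time in [D], for an arbitrary set
   [D]: a time interval is the usual choice, a single instant gives the pointwise
   equations. No regularity is asked of [z3], [u] and [y], whose derivatives do
   not occur. *)
Definition is_solution (R : realType) (n1 n2 n3 m : nat)
    (S : energy_system R n1 n2 n3 m) (D : set R)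
    (z1 : R -> 'cV[R]_n1) (z2 : R -> 'cV[R]_n2) (z3 : R -> 'cV[R]_n3)
    (u y : R -> 'cV[R]_m) : Prop :=
  forall t, D t ->
    let dH1 := gradient (fun x => energy S (x, z2 t)) (z1 t) in
    let dH2 := gradient (fun x => energy S (z1 t, x)) (z2 t) in
    let w := col_mx (derive1 z1 t) (col_mx dH2 (z3 t)) in
    [/\ derivable z1 t 1,
        derivable z2 t 1,
        col_mx dH1 (col_mx (derive1 z2 t) 0) =
          (Jmx S - Rmx S) *m w
          + col_mx (B1mx S) (col_mx (B2mx S) (B3mx S)) *m u t
      & y t = row_mx (B1mx S)^T (row_mx (B2mx S)^T (B3mx S)^T) *m w].

Definition stack (R : realType) (p q : nat) (f : R -> 'cV[R]_p)
    (g : R -> 'cV[R]_q) : R -> 'cV[R]_(p + q) :=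
  fun t => col_mx (f t) (g t).

(* [v1] and [v2] are the new inputs; the inputs of the two subsystems become
   internal variables. *)
Definition is_interconnected_solution (R : realType)
    (n1 n2 n3 m k1 k2 k3 p : nat)
    (S : energy_system R n1 n2 n3 m) (T : energy_system R k1 k2 k3 p)
    (Fskew Fsym : 'M[R]_(m + p)) (D : set R)
    (z1 : R -> 'cV[R]_n1) (z2 : R -> 'cV[R]_n2) (z3 : R -> 'cV[R]_n3)
    (x1 : R -> 'cV[R]_k1) (x2 : R -> 'cV[R]_k2) (x3 : R -> 'cV[R]_k3)
    (v1 : R -> 'cV[R]_m) (v2 : R -> 'cV[R]_p)
    (y1 : R -> 'cV[R]_m) (y2 : R -> 'cV[R]_p) : Prop :=
  exists (u1 : R -> 'cV[R]_m) (u2 : R -> 'cV[R]_p),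
    [/\ is_solution S D z1 z2 z3 u1 y1,
        is_solution T D x1 x2 x3 u2 y2
      & forall t, D t ->
          col_mx (u1 t) (u2 t) =
            (Fskew - Fsym) *m col_mx (y1 t) (y2 t) + col_mx (v1 t) (v2 t)].

(* Main.v *)
(** The total energy is the sum of the two energies. Stacking the two state
    equations gives a block-diagonal system with skew part [diag(J1, J2)],
    dissipative part [diag(R1, R2)] and input matrix [C = diag(B1, B2)], up to
    the permutation [P] that groups the blocks by type instead of by subsystem.
    Its output is [y = C^T w], so the feedback [u = (Fskew - Fsym) y + v] adds
    [C Fskew C^T], which is skew, and [C Fsym C^T], which is symmetric positive
    semi-definite; conjugating by [P] preserves both properties. *)

Require Import Defs.
From mathcomp Require Import all_boot all_order all_algebra.
From mathcomp Require Import all_classical all_reals all_analysis.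
Import Order.TTheory GRing.Theory Num.Theory.
Import numFieldNormedType.Exports.
Local Open Scope classical_set_scope.
Local Open Scope ring_scope.

Set Implicit Arguments.
Unset Strict Implicit.

(** * Closure properties of positive semi-definite matrices *)

Lemma psdmxD (R : realType) n (A B : 'M[R]_n) :
  psdmx A -> psdmx B -> psdmx (A + B).
Proof. by move=> hA hB x; rewrite mulmxDr mulmxDl mxE addr_ge0. Qed.

Lemma psdmx_congr (R : realType) n k (P : 'M[R]_(k, n)) (A : 'M[R]_n) :
  psdmx A -> psdmx (P *m A *m P^T).
Proof.
by move=> hA x; have := hA (P^T *m x); rewrite trmx_mul trmxK !mulmxA.
Qed.

Lemma psdmx_diag (R : realType) n k (A : 'M[R]_n) (B : 'M[R]_k) :
  psdmx A -> psdmx B -> psdmx (block_mx A 0 0 B).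
Proof.
move=> hA hB x; rewrite -[x]vsubmxK tr_col_mx mul_row_block !mulmx0 addr0 add0r.
by rewrite mul_row_col mxE addr_ge0.
Qed.

(** * Derivatives of stacked functions and of the total energy *)

Lemma eq_derive_increment (R : realType) (U V W : normedModType R) (f : U -> W)
    (g : V -> W) a v b w :
  (forall h : R, f (h *: v + a) - f a = g (h *: w + b) - g b) ->
  'D_v f a = 'D_w g b.
Proof. by move=> fg; rewrite /derive /=; under eq_fun do rewrite fg. Qed.

(** A basis vector of one block leaves the other block fixed, so the other summand cancels from the
    increment. Since a directional derivative sees only increments, it may be compared with one on
    the smaller space. *)
Lemma gradient_sum (R : realType) n k (f : 'cV[R]_n -> R) (g : 'cV[R]_k -> R)
    (a : 'cV[R]_n) (b : 'cV[R]_k) :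
  gradient (fun x => f (usubmx x) + g (dsubmx x)) (col_mx a b) =
  col_mx (gradient f a) (gradient g b).
Proof.
apply/matrixP => i j; rewrite -(splitK i).
case: (fintype.split i) => {}i /=.
- rewrite col_mxEu !mxE delta_mx_ushift.
  apply: eq_derive_increment => h.
  rewrite scale_col_mx add_col_mx !col_mxKu !col_mxKd scaler0 add0r.
  by rewrite opprD addrACA subrr addr0.
- rewrite col_mxEd !mxE delta_mx_dshift.
  apply: eq_derive_increment => h.
  rewrite scale_col_mx add_col_mx !col_mxKu !col_mxKd scaler0 add0r.
  by rewrite opprD addrACA subrr add0r.
Qed.

Lemma derivable_stack (R : realType) n k (f : R -> 'cV[R]_n) (g : R -> 'cV[R]_k)
    (t v : R) :
  derivable (stack f g) t v <-> derivable f t v /\ derivable g t v.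
Proof.
have eu i j : (fun s => stack f g s (lshift k i) j) = (fun s => f s i j).
  by apply/funext => s; rewrite /stack col_mxEu.
have ed i j : (fun s => stack f g s (rshift n i) j) = (fun s => g s i j).
  by apply/funext => s; rewrite /stack col_mxEd.
split=> [/derivable_mxP h|[/derivable_mxP hf /derivable_mxP hg]].
  by split; apply/derivable_mxP => i j; rewrite -?eu -?ed; exact: h.
apply/derivable_mxP => i j; rewrite -(splitK i).
case: (fintype.split i) => {}i /=.
  by rewrite eu.
by rewrite ed.
Qed.

Lemma derive1_stack (R : realType) n k (f : R -> 'cV[R]_n) (g : R -> 'cV[R]_k)
    (t : R) :
  derivable f t 1 -> derivable g t 1 ->
  derive1 (stack f g) t = col_mx (derive1 f t) (derive1 g t).
Proof.
move=> df dg; have dfg := (derivable_stack _ _ _ _).2 (conj df dg).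
rewrite !derive1E (derive_mx dfg) (derive_mx df) (derive_mx dg).
apply/matrixP => i j; rewrite -(splitK i).
case: (fintype.split i) => {}i /=.
- rewrite col_mxEu !mxE; congr ('D_1 _ t).
  by apply/funext => s; rewrite /stack col_mxEu.
- rewrite col_mxEd !mxE; congr ('D_1 _ t).
  by apply/funext => s; rewrite /stack col_mxEd.
Qed.

(** The map is linear, so continuity suffices; each entry of the block is an entry of the whole
    matrix, hence the same radius works. *)
Lemma differentiable_usubmx (R : realType) n k m (v : 'M[R]_(n + k, m)) :
  differentiable (usubmx : 'M[R]_(n + k, m) -> 'M[R]_(n, m)) v.
Proof.
apply: linear_differentiable => u A /nbhs_ballP[e /= e0 eA].
apply/nbhs_ballP; exists e => //= w [_ uw]; apply: eA; split => // i j.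
by apply: (le_lt_trans _ (uw (lshift k i) j)); rewrite !mxE.
Qed.

Lemma differentiable_dsubmx (R : realType) n k m (v : 'M[R]_(n + k, m)) :
  differentiable (dsubmx : 'M[R]_(n + k, m) -> 'M[R]_(k, m)) v.
Proof.
apply: linear_differentiable => u A /nbhs_ballP[e /= e0 eA].
apply/nbhs_ballP; exists e => //= w [_ uw]; apply: eA; split => // i j.
by apply: (le_lt_trans _ (uw (rshift n i) j)); rewrite !mxE.
Qed.

Definition sum_energy (R : realType) n1 n2 k1 k2
    (H : 'cV[R]_n1 * 'cV[R]_n2 -> R) (G : 'cV[R]_k1 * 'cV[R]_k2 -> R)
    (q : 'cV[R]_(n1 + k1) * 'cV[R]_(n2 + k2)) : R :=
  H (usubmx q.1, usubmx q.2) + G (dsubmx q.1, dsubmx q.2).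

Lemma sum_energy_differentiable (R : realType) n1 n2 k1 k2
    (H : 'cV[R]_n1 * 'cV[R]_n2 -> R) (G : 'cV[R]_k1 * 'cV[R]_k2 -> R) q :
  (forall z, differentiable H z) -> (forall z, differentiable G z) ->
  differentiable (sum_energy H G) q.
Proof.
move=> dH dG.
have dfst : differentiable (fst : _ -> 'cV[R]_(n1 + k1)) q.
  by apply: linear_differentiable; move=> x; exact: cvg_fst.
have dsnd : differentiable (snd : _ -> 'cV[R]_(n2 + k2)) q.
  by apply: linear_differentiable; move=> x; exact: cvg_snd.
apply: differentiableD.
  apply: (@differentiable_comp _ _ _ _ (fun q => (usubmx q.1, usubmx q.2)) H).
    by apply: differentiable_pair; apply: differentiable_comp => //;
      exact: differentiable_usubmx.
  exact: dH.
apply: (@differentiable_comp _ _ _ _ (fun q => (dsubmx q.1, dsubmx q.2)) G).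
  by apply: differentiable_pair; apply: differentiable_comp => //;
    exact: differentiable_dsubmx.
exact: dG.
Qed.

(** * Regrouping the blocks by type *)

(* The permutation matrix from the block order
   [(z1, z2, z3), (x1, x2, x3)] to [(z1, x1), (z2, x2), (z3, x3)]. *)
Definition riffle_mx (R : realType) n1 n2 n3 k1 k2 k3 :
    'M[R]_((n1 + k1) + ((n2 + k2) + (n3 + k3)),
           (n1 + (n2 + n3)) + (k1 + (k2 + k3))) :=
  col_mx (block_mx (row_mx 1%:M 0) 0 0 (row_mx 1%:M 0))
    (col_mx (block_mx (row_mx 0 (row_mx 1%:M 0)) 0 0 (row_mx 0 (row_mx 1%:M 0)))
      (block_mx (row_mx 0 (row_mx 0 1%:M)) 0 0 (row_mx 0 (row_mx 0 1%:M)))).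

Lemma mul_riffle_col (R : realType) n1 n2 n3 k1 k2 k3 p
    (a1 : 'M[R]_(n1, p)) (a2 : 'M[R]_(n2, p)) (a3 : 'M[R]_(n3, p))
    (b1 : 'M[R]_(k1, p)) (b2 : 'M[R]_(k2, p)) (b3 : 'M[R]_(k3, p)) :
  riffle_mx R n1 n2 n3 k1 k2 k3 *m
    col_mx (col_mx a1 (col_mx a2 a3)) (col_mx b1 (col_mx b2 b3)) =
  col_mx (col_mx a1 b1) (col_mx (col_mx a2 b2) (col_mx a3 b3)).
Proof.
rewrite /riffle_mx !mul_col_mx !mul_row_col.
by rewrite !(mul0mx, mul1mx, addr0, add0r).
Qed.

(** This half of orthogonality serves twice: it cancels the products [P^T *m P] inside the closed
    loop, and it makes left multiplication by [P] injective. *)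
Lemma tr_riffle_mul (R : realType) n1 n2 n3 k1 k2 k3 :
  (riffle_mx R n1 n2 n3 k1 k2 k3)^T *m riffle_mx R n1 n2 n3 k1 k2 k3 = 1%:M.
Proof.
(* [r0] and [l0] pull a common zero block out of stacked rows, which brings the product and the
   block form of the identity to one normal form. *)
have r0 m1 m2 l1 l2 (A : 'M[R]_(m1, l1)) (B : 'M[R]_(m2, l1)) :
    col_mx (row_mx A 0) (row_mx B 0) =
    row_mx (col_mx A B) (0 : 'M[R]_(m1 + m2, l2)).
  by rewrite -[LHS]/(block_mx _ _ _ _) block_mxEh col_mx0.
have l0 m1 m2 l1 l2 (A : 'M[R]_(m1, l1)) (B : 'M[R]_(m2, l1)) :
    col_mx (row_mx 0 A) (row_mx 0 B) =
    row_mx (0 : 'M[R]_(m1 + m2, l2)) (col_mx A B).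
  by rewrite -[LHS]/(block_mx _ _ _ _) block_mxEh col_mx0.
rewrite /riffle_mx !(tr_col_mx, tr_row_mx, trmx0, trmx1, mul_row_col).
rewrite !(mul_col_mx, mul_mx_row, mulmx0, mul0mx, mulmx1, row_mx0, col_mx0).
rewrite !(add_row_mx, add_col_mx, addr0, add0r).
by rewrite !scalar_mx_block /block_mx !(r0, l0).
Qed.

Lemma tr_congr (R : realType) n k (P : 'M[R]_(k, n)) (A : 'M[R]_n) :
  (P *m A *m P^T)^T = P *m A^T *m P^T.
Proof. by rewrite !trmx_mul trmxK mulmxA. Qed.

Lemma tr_block_diag (R : realType) m1 m2 l1 l2 (A : 'M[R]_(m1, l1))
    (B : 'M[R]_(m2, l2)) :
  (block_mx A 0 0 B)^T = block_mx A^T 0 0 B^T.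
Proof. by rewrite tr_block_mx !trmx0. Qed.

(** * The interconnected system and its equations *)

Definition Bmx (R : realType) n1 n2 n3 m (S : energy_system R n1 n2 n3 m) :=
  col_mx (B1mx S) (col_mx (B2mx S) (B3mx S)).

Section interconnection.
Variables (R : realType) (n1 n2 n3 m k1 k2 k3 p : nat).
Variables (S : energy_system R n1 n2 n3 m) (T : energy_system R k1 k2 k3 p).

Local Notation P := (riffle_mx R n1 n2 n3 k1 k2 k3).

Let C := block_mx (Bmx S) 0 0 (Bmx T).

(** The expression is linear in [(X, Y, F)] jointly, so one formula covers the skew part, the
    dissipative part and their difference. *)
Let closed_loop X Y F := P *m (block_mx X 0 0 Y + C *m F *m C^T) *m P^T.

Variables (Fskew Fsym : 'M[R]_(m + p)).
Hypotheses (Fskew_skew : Fskew = - Fskew^T) (Fsym_sym : Fsym = Fsym^T).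
Hypothesis Fsym_psd : psdmx Fsym.

Lemma closed_loop_skew :
  closed_loop (Jmx S) (Jmx T) Fskew = - (closed_loop (Jmx S) (Jmx T) Fskew)^T.
Proof.
rewrite /closed_loop tr_congr [(_ + _)^T]linearD /= tr_congr
  [(block_mx (Jmx S) _ _ _)^T]tr_block_diag.
rewrite -mulNmx -mulmxN opprD opp_block_mx !oppr0 -!Jmx_skew.
by rewrite -mulNmx -mulmxN -Fskew_skew.
Qed.

Lemma closed_loop_sym :
  closed_loop (Rmx S) (Rmx T) Fsym = (closed_loop (Rmx S) (Rmx T) Fsym)^T.
Proof.
by rewrite /closed_loop tr_congr [(_ + _)^T]linearD /= tr_congr
  [(block_mx (Rmx S) _ _ _)^T]tr_block_diag
  -!Rmx_sym -Fsym_sym.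
Qed.

Lemma closed_loop_psd : psdmx (closed_loop (Rmx S) (Rmx T) Fsym).
Proof.
apply/psdmx_congr/psdmxD; last exact: psdmx_congr.
by apply: psdmx_diag; exact: Rmx_psd.
Qed.

(** The energy and the two structure matrices are implicit arguments, read off from the types of the
    four proofs. *)
Definition interconnection :
    energy_system R (n1 + k1) (n2 + k2) (n3 + k3) (m + p) :=
  EnergySystem (block_mx (B1mx S) 0 0 (B1mx T)) (block_mx (B2mx S) 0 0 (B2mx T))
    (block_mx (B3mx S) 0 0 (B3mx T))
    (fun q => sum_energy_differentiable q
      (@energy_differentiable _ _ _ _ _ S) (@energy_differentiable _ _ _ _ _ T))
    closed_loop_skew closed_loop_sym closed_loop_psd.

(** The two column blocks of [C] are treated separately: each is the input matrix of one subsystem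
    padded with zeros for the other, a stack that [P] riffles. *)
Lemma Bmx_interconnection : Bmx interconnection = P *m C.
Proof.
have := mul_riffle_col (B1mx S) (B2mx S) (B3mx S)
  (0 : 'M[R]_(k1, m)) (0 : 'M[R]_(k2, m)) (0 : 'M[R]_(k3, m)).
have := mul_riffle_col (0 : 'M[R]_(n1, p)) (0 : 'M[R]_(n2, p))
  (0 : 'M[R]_(n3, p)) (B1mx T) (B2mx T) (B3mx T).
rewrite !col_mx0 => eT eS.
rewrite [C]block_mxEh mul_mx_row eS eT /Bmx /= !block_mxEh.
by rewrite -block_mxEv block_mxEh -block_mxEv block_mxEh.
Qed.

Lemma system_matrix_interconnection :
  Jmx interconnection - Rmx interconnection =
  closed_loop (Jmx S - Rmx S) (Jmx T - Rmx T) (Fskew - Fsym).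
Proof.
rewrite /= /closed_loop -mulmxBl -mulmxBr opprD addrACA -mulmxBl -mulmxBr.
by rewrite opp_block_mx add_block_mx !oppr0 !addr0.
Qed.

(** This is the linear algebra at one instant: [l1], [l2] stand for the left-hand sides and [w1],
    [w2] for the vectors of efforts and flows, all arbitrary here. *)
Lemma interconnection_equations
    (l1 w1 : 'cV[R]_(n1 + (n2 + n3))) (l2 w2 : 'cV[R]_(k1 + (k2 + k3)))
    (y1 v1 : 'cV[R]_m) (y2 v2 : 'cV[R]_p) :
  let F := Fskew - Fsym in
  let I := interconnection in
  let w := P *m col_mx w1 w2 in
  let u := F *m col_mx y1 y2 + col_mx v1 v2 in
  P *m col_mx l1 l2 = (Jmx I - Rmx I) *m w + Bmx I *m col_mx v1 v2 /\
    col_mx y1 y2 = (Bmx I)^T *m w <->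
  (l1 = (Jmx S - Rmx S) *m w1 + Bmx S *m usubmx u /\ y1 = (Bmx S)^T *m w1) /\
  (l2 = (Jmx T - Rmx T) *m w2 + Bmx T *m dsubmx u /\ y2 = (Bmx T)^T *m w2).
Proof.
move=> F I w u.
have P_inj x y : P *m x = P *m y :> 'cV_(_ + _) -> x = y.
  by move=> /(congr1 (mulmx P^T)); rewrite !mulmxA !tr_riffle_mul !mul1mx.
have CTw : (Bmx I)^T *m w = col_mx ((Bmx S)^T *m w1) ((Bmx T)^T *m w2).
  rewrite Bmx_interconnection trmx_mul -mulmxA (mulmxA P^T).
  rewrite tr_riffle_mul mul1mx.
  by rewrite tr_block_diag mul_block_col !mul0mx addr0 add0r.
(* The state equations match only once the output equation is known, since the feedback acts on [y]
   while the closed loop contains [C^T] applied to the stacked [w1], [w2]. *)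
have rhs : col_mx y1 y2 = (Bmx I)^T *m w ->
    (Jmx I - Rmx I) *m w + Bmx I *m col_mx v1 v2 =
    P *m col_mx ((Jmx S - Rmx S) *m w1 + Bmx S *m usubmx u)
                ((Jmx T - Rmx T) *m w2 + Bmx T *m dsubmx u).
  move=> yw.
  (* Solving the feedback law for the new input produces a term that cancels the feedback
     contribution in the closed loop. *)
  have -> : col_mx v1 v2 = u - F *m ((Bmx I)^T *m w).
    by rewrite -yw addrAC subrr add0r.
  rewrite system_matrix_interconnection Bmx_interconnection /closed_loop.
  rewrite -/F trmx_mul /w -!mulmxA (mulmxA P^T) tr_riffle_mul mul1mx -mulmxDr.
  congr (P *m _); rewrite mulmxDl mulmxBr !mulmxA addrACA subrr addr0.
  rewrite -[in C *m u](vsubmxK u) !mul_block_col !mul0mx !addr0 !add0r.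
  by rewrite add_col_mx.
rewrite CTw in rhs *.
split=> [[eq_l eq_y]|[[-> y1E] [-> y2E]]].
  move: eq_l; rewrite (rhs eq_y) => /P_inj/eq_col_mx[-> ->].
  by case/eq_col_mx: eq_y => <- <-.
by rewrite rhs y1E y2E.
Qed.

(** The internal inputs are eliminated: they are the two halves of the feedback [u], a function of
    the outputs and new inputs. *)
Lemma interconnection_solution D z1 z2 z3 x1 x2 x3 v1 v2 y1 y2 :
  let u t := (Fskew - Fsym) *m stack y1 y2 t + stack v1 v2 t in
  is_solution interconnection D (stack z1 x1) (stack z2 x2) (stack z3 x3)
    (stack v1 v2) (stack y1 y2) <->
  is_solution S D z1 z2 z3 (fun t => usubmx (u t)) y1 /\
  is_solution T D x1 x2 x3 (fun t => dsubmx (u t)) y2.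
Proof.
move=> u.
have grad1 t : gradient (fun x => energy interconnection (x, stack z2 x2 t))
    (stack z1 x1 t) =
  col_mx (gradient (fun x => energy S (x, z2 t)) (z1 t))
         (gradient (fun x => energy T (x, x2 t)) (x1 t)).
  rewrite -gradient_sum; congr gradient; apply/funext => x.
  by rewrite /= /sum_energy /stack /= col_mxKu col_mxKd.
have grad2 t : gradient (fun x => energy interconnection (stack z1 x1 t, x))
    (stack z2 x2 t) =
  col_mx (gradient (fun x => energy S (z1 t, x)) (z2 t))
         (gradient (fun x => energy T (x1 t, x)) (x2 t)).
  rewrite -gradient_sum; congr gradient; apply/funext => x.
  by rewrite /= /sum_energy /stack /= col_mxKu col_mxKd.
pose w1 t := col_mx (derive1 z1 t)
  (col_mx (gradient (fun x => energy S (z1 t, x)) (z2 t)) (z3 t)).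
pose w2 t := col_mx (derive1 x1 t)
  (col_mx (gradient (fun x => energy T (x1 t, x)) (x2 t)) (x3 t)).
pose l1 t := col_mx (gradient (fun x => energy S (x, z2 t)) (z1 t))
  (col_mx (derive1 z2 t) (0 : 'cV[R]_n3)).
pose l2 t := col_mx (gradient (fun x => energy T (x, x2 t)) (x1 t))
  (col_mx (derive1 x2 t) (0 : 'cV[R]_k3)).
have eqs t := interconnection_equations (l1 t) (w1 t) (l2 t) (w2 t)
  (y1 t) (v1 t) (y2 t) (v2 t).
split=> [sol|[solS solT] t Dt].
  suff sols t : D t ->
      [/\ derivable z1 t 1, derivable z2 t 1,
          l1 t = (Jmx S - Rmx S) *m w1 t + Bmx S *m usubmx (u t)
        & y1 t = (Bmx S)^T *m w1 t] /\
      [/\ derivable x1 t 1, derivable x2 t 1,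
          l2 t = (Jmx T - Rmx T) *m w2 t + Bmx T *m dsubmx (u t)
        & y2 t = (Bmx T)^T *m w2 t].
    by split=> t /sols[[? ? ? ?] [? ? ? ?]]; split; rewrite -?tr_col_mx.
  move=> /sol[/derivable_stack[dz1 dx1] /derivable_stack[dz2 dx2]].
  rewrite grad1 grad2 !derive1_stack // -!tr_col_mx => eq_l eq_y.
  (* Here [col_mx0] merges the zero left-hand sides of the two algebraic constraints into one zero
     block. *)
  have := (eqs t).1; rewrite !mul_riffle_col col_mx0 => eqs1.
  by have [[? ?] [? ?]] := eqs1 (conj eq_l eq_y).
have [dz1 dz2 eq_l1 eq_y1] := solS t Dt.
have [dx1 dx2 eq_l2 eq_y2] := solT t Dt.
rewrite -!tr_col_mx in eq_y1 eq_y2.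
have [] := (eqs t).2 (conj (conj eq_l1 eq_y1) (conj eq_l2 eq_y2)).
rewrite !mul_riffle_col col_mx0 => eq_l eq_y.
by split; [exact/derivable_stack|exact/derivable_stack| |];
  rewrite ?grad1 grad2 !derive1_stack // -!tr_col_mx.
Qed.

End interconnection.

Theorem lemma2p4 (R : realType) (n1 n2 n3 m k1 k2 k3 p : nat)
  (S1 : energy_system R n1 n2 n3 m) (S2 : energy_system R k1 k2 k3 p)
  (Fskew Fsym : 'M[R]_(m + p))
  (Fskew_skew : Fskew = - Fskew^T)
  (Fsym_sym : Fsym = Fsym^T) (Fsym_psd : psdmx Fsym) :
  exists S : energy_system R (n1 + k1) (n2 + k2) (n3 + k3) (m + p),
    forall (D : set R)
      (z1 : R -> 'cV[R]_n1) (z2 : R -> 'cV[R]_n2) (z3 : R -> 'cV[R]_n3)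
      (x1 : R -> 'cV[R]_k1) (x2 : R -> 'cV[R]_k2) (x3 : R -> 'cV[R]_k3)
      (v1 : R -> 'cV[R]_m) (v2 : R -> 'cV[R]_p)
      (y1 : R -> 'cV[R]_m) (y2 : R -> 'cV[R]_p),
      is_interconnected_solution S1 S2 Fskew Fsym D
        z1 z2 z3 x1 x2 x3 v1 v2 y1 y2 <->
      is_solution S D (stack z1 x1) (stack z2 x2) (stack z3 x3)
        (stack v1 v2) (stack y1 y2).
Proof.
exists (interconnection S1 S2 Fskew_skew Fsym_sym Fsym_psd).
move=> D z1 z2 z3 x1 x2 x3 v1 v2 y1 y2.
split=> [[u1 [u2 [sol1 sol2 loop]]]|/interconnection_solution[sol1 sol2]].
  (* The given inputs agree with the feedback at times in [D], exactly where the equations are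
     evaluated. *)
  apply/interconnection_solution; split=> t Dt; rewrite /stack -loop //.
    by rewrite col_mxKu; exact: sol1.
  by rewrite col_mxKd; exact: sol2.
(* The inputs are the halves of the feedback, as fixed by [sol1] and [sol2]; stacking them restores
   the interconnection law at every time. *)
eexists; eexists; split; [exact: sol1|exact: sol2|].
by move=> t _; rewrite vsubmxK.
Qed.
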